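(* Let $k$ be a kernel with finite second moment, that is $\sum_{j\in\mathbb{N}}k(j)j^2<\infty$, and assume that there is some $j_0\in\mathbb{N}$ such that $k$ is non-increasing on $\{j\in\mathbb{N}: j\ge j_0\}$. Then the corresponding operator $\mathcal{L}$ satisfies $CD(0,d)$ for some finite $d>0$.
   Context: $\mathbb{N}=\{1,2,\dots\}$. A kernel is a function $k:\mathbb{Z}\to[0,\infty)$ with $k(0)=0$, $k(-j)=k(j)$ for all $j\in\mathbb{N}$, and $0<|k|_1:=\sum_{j\in\mathbb{Z}}k(j)<\infty$. The associated operator is $\mathcal{L}u(x)=\sum_{j\in\mathbb{Z}}k(j)\big(u(x+j)-u(x)\big)$, $x\in\mathbb{Z}$, and the iterated carré du champ operator is given by $\Gamma_2(u)(x)=\frac14\sum_{j,l\in\mathbb{Z}}k(j)k(l)\big(u(x+j+l)-u(x+j)-u(x+l)+u(x)\big)^2\in[0,\infty]$. A function $u:\mathbb{Z}\to\mathbb{R}$ is admissible for $CD(0,d)$ at $x\in\mathbb{Z}$ if $\sum_{j\in\mathbb{Z}}k(j)|u(x+j)|<\infty$. For $d\in(0,\infty)$, $\mathcal{L}$ satisfies $CD(0,d)$ if $\Gamma_2(u)(x)\ge\frac1d\big(\mathcal{L}u(x)\big)^2$ for every $x\in\mathbb{Z}$ and every $u$ admissible at $x$. *)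

(* Defs.v *)
From mathcomp Require Import all_boot all_order all_algebra.
From mathcomp Require Import boolp classical_sets functions fsbigop reals ereal numfun esum.

Set Implicit Arguments.
Unset Strict Implicit.
Unset Printing Implicit Defensive.

Import Order.TTheory GRing.Theory Num.Theory.

Local Open Scope classical_set_scope.
Local Open Scope ring_scope.

Section CarreDuChamp.
Variable R : realType.
Implicit Types (k u : int -> R) (x : int) (d : R).

Record is_kernel k : Prop := IsKernel {
  kernel_ge0 : forall j, 0 <= k j;
  kernel0 : k 0 = 0;
  kernel_sym : forall j : nat, (0 < j)%N -> k (- j%:Z) = k j%:Z;
  kernel_mass_gt0 : (0 < \esum_(j in [set: int]) (k j)%:E)%E;
  kernel_mass_fin : (\esum_(j in [set: int]) (k j)%:E < +oo)%E
}.

(* [esum] is only meaningful for nonnegative families, so an absolutely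
   convergent signed sum is the sum of the positive parts minus the sum of the
   negative parts.  If the family is not absolutely summable, the value
   returned has no meaning. *)
Definition zsum (f : int -> R) : R :=
  fine (\esum_(j in [set: int]) (f^\+ j)%:E
        - \esum_(j in [set: int]) (f^\- j)%:E)%E.

(* For a kernel [k], the family summed here is absolutely summable when [u] is
   admissible at [x] (see below). *)
Definition gen k u x : R := zsum (fun j => k j * (u (x + j) - u x)).

Definition Gamma2 k u x : \bar R :=
  ((4^-1)%:E * \esum_(p in [set: int * int])
     (k p.1 * k p.2 *
       (u (x + p.1 + p.2) - u (x + p.1) - u (x + p.2) + u x) ^+ 2)%:E)%E.

Definition admissible k u x : Prop :=
  (\esum_(j in [set: int]) (k j * `|u (x + j)|)%:E < +oo)%E.

(* The curvature-dimension condition CD(0, d), for a real d > 0. *)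
Definition CD0 k d : Prop :=
  forall x u, admissible k u x -> ((d^-1 * gen k u x ^+ 2)%:E <= Gamma2 k u x)%E.

Lemma gen_summable k u x : is_kernel k -> admissible k u x ->
  summable [set: int] (fun j => (k j * (u (x + j) - u x))%:E).
Proof.
move=> kk adm.
have k0 := kernel_ge0 kk.
have s1 : summable [set: int] (fun j => (k j * u (x + j))%:E).
  rewrite /summable; apply: le_lt_trans adm; apply: le_esum => j _.
  by rewrite /= lee_fin normrM (ger0_norm (k0 j)).
have s2 : summable [set: int] (fun j => (k j * u x)%:E).
  rewrite /summable.
  rewrite (eq_esum (b := fun j => (`|u x| * k j)%:E)); last first.
    by move=> j _; rewrite /= normrM (ger0_norm (k0 j)) mulrC.
  have bnd : (\esum_(j in [set: int]) (`|u x| * k j)%:E <=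
              `|u x|%:E * \esum_(j in [set: int]) (k j)%:E)%E.
    apply: ge_ereal_sup => _ [A [finA _] <-].
    under eq_fsbigr => j _ do rewrite EFinM.
    rewrite -ge0_mule_fsumr; last by move=> j; rewrite lee_fin.
    by rewrite lee_wpmul2l ?lee_fin//; apply: ereal_sup_ubound; exists A.
  apply: le_lt_trans bnd _.
  have fin : (\esum_(j in [set: int]) (k j)%:E)%E \is a fin_num.
    rewrite ge0_fin_numE ?kernel_mass_fin//.
    by apply: esum_ge0 => j _; rewrite lee_fin.
  by rewrite -(fineK fin) -EFinM ltry.
have := summableB s1 s2; congr (is_true (summable _ _)).
by apply/funext => j /=; rewrite -EFinB mulrBr.
Qed.

End CarreDuChamp.

(* Main.v *)
Require Import Defs.
From mathcomp Require Import all_boot all_order all_algebra.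
From mathcomp Require Import boolp classical_sets reals ereal numfun esum.
From mathcomp Require Import cardinality fsbigop finmap.
From mathcomp Require Import zify ring lra.

Import Order.TTheory GRing.Theory Num.Theory.

Local Open Scope classical_set_scope.
Local Open Scope ring_scope.

(** Fix u and x, let D(p, q) be the second difference
    u(x+p+q) - u(x+p) - u(x+q) + u(x), so that 4 Gamma2 is the sum of
    k(p) k(q) D(p, q)^2, and fold Lu(x) into the sum over j >= 1 of k(j) g(j)
    with g(j) = u(x+j) + u(x-j) - 2 u(x).  It suffices to bound all partial
    sums of k(j) |g(j)| by C s, where Gamma2 <= s^2 and C depends on k only.

    The pairs (j, -j) give k(j) |g(j)| <= 2 s for each single j
    ([kernel_symdiff_le]); this settles any finite range of j, hence every
    kernel of finite support.  A monotone kernel of infinite support is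
    positive from some N on, and then g is controlled far out by its values
    near N, because it is additive up to an error that Gamma2 sees:
      g(j+N) = g(j) + g(N) + e(j),  e(j) = D(j, N) + D(-j, -N)
    ([symdiffD]).  The pairs (j, N) and (-j, -N) make the sum of k(j) e(j)^2
    at most a constant times s^2 ([sum_defect_le]), and iterating the identity
    yields |g(j)| <= a j + sum of |e(i)| over N <= i < j, with a of order s
    ([almost_additive_growth]).

    Summed against k, the linear part costs a first moment.  For the other
    part, exchange the sums: it is the sum of |e(i)| K_i, where K_i is the
    tail of k beyond i.  Monotonicity enters through
    K_i^2 <= 2 k(i) (sum of m k(m) over m > i) ([sqr_tail_sum_le]): after
    Cauchy-Schwarz against k(i) e(i)^2, what remains is the sum over i of the
    tails of m k(m), that is, the second moment of k
    ([weighted_double_sum_le]). *)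

(** * Unconditional sums over the integers *)

Lemma sum_le_esum (R : realType) (T : choiceType) (S : set T) (a : T -> R)
    (s : seq T) :
  uniq s -> [set` s] `<=` S ->
  ((\sum_(i <- s) a i)%:E <= \esum_(i in S) (a i)%:E)%E.
Proof.
move=> us sS; apply: esum_ge; exists [set` s]; first by split.
by rewrite -fsbig_seq// sumEFin.
Qed.

Definition window (n : nat) : seq int :=
  0 :: [seq j%:Z | j <- index_iota 1 n.+1] ++
       [seq - j%:Z | j <- index_iota 1 n.+1].

Lemma mem_window n (i : int) : (i \in window n) = (`|i| <= n)%N.
Proof.
rewrite /window inE mem_cat; apply/idP/idP.
  case/or3P=> [/eqP->//|/mapP[j]|/mapP[j]]; rewrite mem_index_iota => jn ->; lia.
case: i => [[//|i]|i] in_; apply/or3P.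
  by apply: Or32; apply/mapP; exists i.+1 => //; rewrite mem_index_iota; lia.
by apply: Or33; apply/mapP; exists i.+1; rewrite ?mem_index_iota; lia.
Qed.

Lemma window_uniq n : uniq (window n).
Proof.
rewrite /window cons_uniq cat_uniq !map_inj_uniq ?iota_uniq/= ?andbT; last 2 first.
- by move=> i j; lia.
- by move=> i j; lia.
apply/andP; split.
  by rewrite mem_cat; apply/negP=> /orP[] /mapP[j]; rewrite mem_index_iota; lia.
apply/hasPn => _ /mapP[j + ->]; rewrite mem_index_iota => jn.
by apply/negP => /mapP[l]; rewrite mem_index_iota; lia.
Qed.

Lemma sum_window (R : nmodType) (f : int -> R) n :
  \sum_(i <- window n) f i =
  f 0 + \sum_(1 <= j < n.+1) (f j%:Z + f (- j%:Z)).
Proof. by rewrite /window big_cons big_cat !big_map big_split. Qed.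

Lemma esum_window (R : realType) (a : int -> R) (e : R) :
  (forall i, 0 <= a i) -> (\esum_(i in [set: int]) (a i)%:E < +oo)%E -> 0 < e ->
  exists n0, forall n, (n0 <= n)%N ->
    fine (\esum_(i in [set: int]) (a i)%:E) - e <= \sum_(i <- window n) a i
      <= fine (\esum_(i in [set: int]) (a i)%:E).
Proof.
move=> a0 afin e0.
have Sfin : (\esum_(i in [set: int]) (a i)%:E)%E \is a fin_num.
  by rewrite ge0_fin_numE// esum_ge0// => i _; rewrite lee_fin.
have [_ [A [Afin _] <-]] := ub_ereal_sup_adherent e0 Sfin.
rewrite -/(esum _ _) fsbig_finite//= sumEFin => lA.
exists (\max_(i <- fset_set A) `|i|%N) => n nA.
rewrite -!lee_fin EFinB fineK// sum_le_esum// ?window_uniq// andbT.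
(* The part of the window that lies in A sums to the same value as A. *)
apply: (le_trans (ltW lA)); rewrite lee_fin.
rewrite [leRHS](bigID (fun i => i \in fset_set A))/= -[leLHS]addr0.
apply: lerD; last exact: sumr_ge0.
rewrite -[leRHS]big_filter le_eqVlt; apply/orP; left; apply/eqP.
apply: perm_big; apply: uniq_perm; rewrite ?filter_uniq ?window_uniq ?fset_uniq//.
move=> i; rewrite mem_filter mem_window.
case: (boolP (i \in fset_set A)) => //= iA; symmetry.
apply: leq_trans nA.
by rewrite (big_rem i)//= leq_max leqnn.
Qed.

(** The positive and the negative parts of f are exhausted by the same large
    window, so [zsum f] is a limit of symmetric partial sums. *)
Lemma zsum_le_window (R : realType) (f : int -> R) (B : R) :
  summable [set: int] (fun j => (f j)%:E) ->
  (forall n, `|\sum_(i <- window n) f i| <= B) -> `|zsum f| <= B.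
Proof.
move=> sf fB; apply/ler_addgt0Pr => e e0.
have fin g : (forall j, 0 <= g j) -> (forall j, g j <= `|f j|) ->
    (\esum_(i in [set: int]) (g i)%:E < +oo)%E.
  move=> g0 gf; apply: le_lt_trans sf; apply: le_esum => j _.
  by rewrite /= lee_fin.
have pge := funrpos_ge0 f; have nge := funrneg_ge0 f.
have pfin : (\esum_(i in [set: int]) (f^\+ i)%:E < +oo)%E.
  by apply: fin => // j; rewrite /funrpos ge_max ler_norm normr_ge0.
have nfin : (\esum_(i in [set: int]) (f^\- i)%:E < +oo)%E.
  by apply: fin => // j; rewrite /funrneg ge_max -normrN ler_norm normr_ge0.
have e2 : 0 < e / 2 by lra.
have [n1 H1] := esum_window _ _ _ pge pfin e2.
have [n2 H2] := esum_window _ _ _ nge nfin e2.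
have {H1} /andP[p1 p2] := H1 (maxn n1 n2) (leq_maxl _ _).
have {H2} /andP[m1 m2] := H2 (maxn n1 n2) (leq_maxr _ _).
have := fB (maxn n1 n2).
have -> : \sum_(i <- window (maxn n1 n2)) f i =
    \sum_(i <- window (maxn n1 n2)) f^\+ i - \sum_(i <- window (maxn n1 n2)) f^\- i.
  by rewrite -sumrB; apply: eq_bigr => i _; rewrite -{1}(funrposBneg f).
rewrite /zsum fineB ?ge0_fin_numE ?esum_ge0//; last 2 first.
- by move=> i _; rewrite lee_fin.
- by move=> i _; rewrite lee_fin.
by rewrite !ler_norml; lra.
Qed.

(** * Weighted sums along a monotone sequence *)

Lemma exchange_triangular (R : nmodType) (F : nat -> nat -> R) (N n : nat) :
  \sum_(N <= j < n) \sum_(N <= i < j) F i j =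
  \sum_(N <= i < n) \sum_(i.+1 <= j < n) F i j.
Proof.
elim: n => [|n IH]; first by rewrite !big_geq.
have [Nn|nN] := leqP N n; last by rewrite !big_geq.
rewrite [LHS]big_nat_recr// [RHS]big_nat_recr//= IH.
rewrite [X in _ = _ + X]big_geq// addr0 -big_split/=.
by apply: eq_big_nat => i /andP[_ iN]; rewrite big_nat_recr.
Qed.

(** Expanding the square gives the terms k(l) k(m); for i < l <= m the factor
    k(l) is at most k(i), and there are at most m such l for each m.  The
    induction on n adds these terms one m at a time. *)
Lemma sqr_tail_sum_le (R : realFieldType) (k : nat -> R) (i n : nat) :
  (forall j, 0 <= k j) -> (forall j, (i <= j)%N -> k j <= k i) ->
  (\sum_(i.+1 <= j < n) k j) ^+ 2 <= 2 * k i * \sum_(i.+1 <= j < n) j%:R * k j.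
Proof.
move=> k0 kd; have [|ni] := leqP i.+1 n; last first.
  by rewrite !(big_geq (ltnW ni)) expr0n /= mulr0 lexx.
elim: n => // n IH; rewrite leq_eqVlt => /predU1P[<-|ni].
  by rewrite !(big_geq (leqnn _)) expr0n /= mulr0 lexx.
rewrite !big_nat_recr//=.
have Kn : \sum_(i.+1 <= j < n) k j <= (n%:R - 1) * k i.
  apply: (@le_trans _ _ (\sum_(i.+1 <= j < n) k i)).
    by apply: ler_sum_nat => j /andP[ij _]; apply/kd/ltnW.
  rewrite sumr_const_nat -[leLHS]mulr_natl; apply: ler_wpM2r => //.
  by rewrite lerBrDr natr1 ler_nat; lia.
have := IH ni; set K := \sum_(_ <= _ < _) k _ in Kn *.
set P := \sum_(_ <= _ < _) _.
have := ler_wpM2r (k0 n) Kn; have := ler_wpM2r (k0 n) (kd n (ltnW ni)).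
have := mulr_ge0 (k0 i) (k0 n).
clear Kn; move: P K (k i) (k n) n%:R => P K ki kn m; lra.
Qed.

(** Cauchy-Schwarz in the form of the inequality between arithmetic and
    geometric means, with the weight s left free: if E is of order s^2, the
    bound is of order s. *)
Lemma weighted_double_sum_le (R : realFieldType) (k e : nat -> R) (N n : nat)
    (E Q s : R) :
  (0 < N)%N -> 0 < s ->
  (forall j, 0 <= k j) -> (forall i, (N <= i)%N -> 0 < k i) ->
  (forall i j, (N <= i)%N -> (i <= j)%N -> k j <= k i) ->
  \sum_(N <= i < n) k i * e i ^+ 2 <= E ->
  \sum_(1 <= j < n) k j * j%:R ^+ 2 <= Q ->
  \sum_(N <= j < n) k j * \sum_(N <= i < j) `|e i| <= E / (2 * s) + s * Q.
Proof.
move=> N0 s0 k0 kpos kd HE HQ.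
have -> : \sum_(N <= j < n) k j * \sum_(N <= i < j) `|e i| =
    \sum_(N <= i < n) `|e i| * \sum_(i.+1 <= j < n) k j.
  under eq_bigr => j _ do rewrite mulr_sumr.
  rewrite exchange_triangular; apply: eq_bigr => i _.
  by rewrite mulr_sumr; apply: eq_bigr => j _; rewrite mulrC.
have termle i : (N <= i < n)%N -> `|e i| * \sum_(i.+1 <= j < n) k j <=
    k i * e i ^+ 2 / (2 * s) + s * \sum_(i.+1 <= j < n) j%:R * k j.
  move=> /andP[Ni _]; have := sqr_tail_sum_le _ _ _ n k0 (fun j => kd i j Ni).
  set K := \sum_(_ <= _ < _) k _; set P := \sum_(_ <= _ < _) _ => KP.
  have ki := kpos _ Ni; rewrite -(real_normK (num_real (e i))).
  set a := `|e i|.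
  rewrite -subr_ge0.
  (* Complete the square in a = |e i| and the tail K. *)
  have -> : k i * a ^+ 2 / (2 * s) + s * P - a * K =
     ((k i * a - s * K) ^+ 2 + s ^+ 2 * (2 * k i * P - K ^+ 2)) / (2 * s * k i).
    by field; rewrite !gt_eqF.
  rewrite divr_ge0 ?addr_ge0 ?sqr_ge0 ?mulr_ge0 ?sqr_ge0 ?subr_ge0// ?ltW//.
apply: le_trans; first exact: ler_sum_nat termle.
rewrite big_split/= -mulr_suml -mulr_sumr -exchange_triangular.
apply: lerD; first by rewrite ler_pdivrMr ?divfK ?gt_eqF ?mulr_gt0.
rewrite ler_pM2l//; apply: le_trans HQ.
apply: (@le_trans _ _ (\sum_(N <= j < n) k j * j%:R ^+ 2)); last first.
  have kj0 j : 0 <= k j * j%:R ^+ 2 by rewrite mulr_ge0// sqr_ge0.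
  have [Nn|nN] := leqP N n; last by rewrite (big_geq (ltnW nN)); exact: sumr_ge0.
  by rewrite [leRHS](big_cat_nat (n := N))//= lerDr; exact: sumr_ge0.
(* Each j k(j) occurs in fewer than j of the tails. *)
apply: ler_sum_nat => j _; rewrite sumr_const_nat -[leLHS]mulr_natl mulrA [leRHS]mulrC.
apply: ler_wpM2r => //.
by rewrite expr2 -!natrM ler_nat leq_mul2r leq_subr orbT.
Qed.

(** Descend from j by steps of N to the interval from N to 2N.  Each step costs
    |g N| <= a and one of the errors; since the steps visit distinct indices,
    the sum of all |e i| below j covers them, whatever j is modulo N. *)
Lemma almost_additive_growth (R : realFieldType) (g e : nat -> R) (N : nat) (a : R) :
  (0 < N)%N ->
  (forall j, (N <= j <= 2 * N)%N -> `|g j| <= a) ->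
  (forall j, (N <= j)%N -> g (j + N)%N = g j + g N + e j) ->
  forall j, (N <= j)%N -> `|g j| <= a * j%:R + \sum_(N <= i < j) `|e i|.
Proof.
move=> N0 ga gN; have a0 : 0 <= a by apply: le_trans (ga N _); rewrite ?normr_ge0; lia.
elim/ltn_ind => j IH Nj; have [j2|j2] := leqP j (2 * N).
  apply: le_trans (ga j _) _; first by rewrite Nj.
  apply: ler_wpDr; first by apply: sumr_ge0.
  by rewrite ler_peMr// ler1n; lia.
have ej : j = (j - N + N)%N by lia.
have Nj' : (N <= j - N)%N by lia.
rewrite {1}ej gN//.
have := IH (j - N)%N ltac:(lia) Nj'.
have aN := ga N ltac:(lia).
have -> : \sum_(N <= i < j) `|e i| =
    \sum_(N <= i < j - N) `|e i| + (`|e (j - N)%N| + \sum_((j - N).+1 <= i < j) `|e i|).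
  by rewrite (big_cat_nat (n := (j - N)%N))//= ?leq_subr// (big_ltn (m := (j - N)%N)) ?ltn_subrL//; lia.
have : 0 <= \sum_((j - N).+1 <= i < j) `|e i| by apply: sumr_ge0.
have := ler_normD (g (j - N)%N + g N) (e (j - N)%N).
have := ler_normD (g (j - N)%N) (g N).
have : a <= a * N%:R by rewrite ler_peMr// ler1n.
have -> : j%:R = (j - N)%:R + N%:R :> R by rewrite -natrD -ej.
rewrite mulrDr; lra.
Qed.

Lemma sum_head_tail_le (R : realFieldType) (F : nat -> R) (b : R) (N n : nat) :
  (0 < N)%N -> (forall j, 0 <= F j <= b) ->
  \sum_(1 <= j < n) F j <= b * N%:R + \sum_(N <= j < n) F j.
Proof.
move=> N0 Fb; have b0 : 0 <= b by have /andP[/le_trans] := Fb 0%N; apply.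
have head m : (m <= N)%N -> \sum_(1 <= j < m) F j <= b * N%:R.
  move=> mN; apply: (@le_trans _ _ (\sum_(1 <= j < m) b)).
    by apply: ler_sum => j _; have /andP[] := Fb j.
  rewrite sumr_const_nat -[leLHS]mulr_natr; apply: ler_wpM2l => //.
  by rewrite ler_nat; lia.
have [Nn|nN] := leqP N n.
  by rewrite (big_cat_nat (n := N))//= lerD2r; exact: head.
by rewrite [X in _ + X](big_geq (ltnW nN)) addr0; apply/head/ltnW.
Qed.

(** * Second differences controlled by the iterated carré du champ *)

Section SecondDifferences.
Context {R : realType}.
Variables (k u : int -> R) (x : int).
Hypothesis hk : is_kernel k.

Definition diff2 (p q : int) : R := u (x + p + q) - u (x + p) - u (x + q) + u x.

Definition symdiff (j : nat) : R := u (x + j%:Z) + u (x - j%:Z) - 2 * u x.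

(** The failure of [symdiff] to be additive under the step N. *)
Definition defect (N j : nat) : R := diff2 j%:Z N%:Z + diff2 (- j%:Z) (- N%:Z).

(** Unlike [kernel_sym], this includes j = 0. *)
Lemma kernelN (j : nat) : k (- j%:Z) = k j%:Z.
Proof. by case: j => [|j]; [rewrite oppr0|exact: (kernel_sym hk)]. Qed.

Lemma symdiffD (N j : nat) :
  symdiff (j + N) = symdiff j + symdiff N + defect N j.
Proof.
rewrite /symdiff /defect /diff2.
rewrite !PoszD !opprD !addrA; ring.
Qed.

Lemma diff2_opp (j : nat) : diff2 j%:Z (- j%:Z) = - symdiff j.
Proof. by rewrite /diff2 /symdiff addrK; ring. Qed.

(** Every estimate below reads off the terms of [Gamma2] at a well chosen
    finite family ps of pairs. *)
Lemma sum_diff2_le (s : R) (ps : seq (int * int)) :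
  (Gamma2 k u x <= (s ^+ 2)%:E)%E -> uniq ps ->
  \sum_(p <- ps) k p.1 * k p.2 * diff2 p.1 p.2 ^+ 2 <= 4 * s ^+ 2.
Proof.
move=> Gs us; have k0 := kernel_ge0 hk.
rewrite -ler_pdivrMl// -lee_fin; apply: le_trans Gs.
rewrite EFinM; apply: lee_wpmul2l; first by rewrite lee_fin invr_ge0.
exact: (sum_le_esum _ _ _ (fun p => k p.1 * k p.2 * diff2 p.1 p.2 ^+ 2)).
Qed.

(** The single pair (j, -j), whose weight is k(j)^2. *)
Lemma kernel_symdiff_le (s : R) (j : nat) : 0 <= s ->
  (Gamma2 k u x <= (s ^+ 2)%:E)%E -> k j%:Z * `|symdiff j| <= 2 * s.
Proof.
move=> s0 /(sum_diff2_le s [:: (j%:Z, - j%:Z)])/(_ isT).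
rewrite big_seq1/= kernelN diff2_opp sqrrN => h.
have kj := kernel_ge0 hk j%:Z.
rewrite -ler_sqr ?nnegrE ?mulr_ge0 ?ler0n//.
rewrite !exprMn real_normK ?num_real// expr2 (le_trans h)//.
by rewrite -natrX.
Qed.

(** The pairs (i, N) and the pairs (-i, -N), all of weight k(i) k(N), together
    with (a + b)^2 <= 2 a^2 + 2 b^2. *)
Lemma sum_defect_le (s : R) (N n : nat) : 0 < k N%:Z ->
  (Gamma2 k u x <= (s ^+ 2)%:E)%E ->
  \sum_(N <= i < n) k i%:Z * defect N i ^+ 2 <= 16 * s ^+ 2 / k N%:Z.
Proof.
move=> kN Gs.
have h1 := sum_diff2_le s [seq (i%:Z, N%:Z) | i <- index_iota N n] Gs.
have h2 := sum_diff2_le s [seq (- i%:Z, - N%:Z) | i <- index_iota N n] Gs.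
have := lerD (h1 _) (h2 _); rewrite !big_map -big_split/=.
rewrite !map_inj_uniq ?iota_uniq; last 2 first.
- by move=> i j [/oppr_inj []].
- by move=> i j [].
move=> /(_ isT isT) h; rewrite ler_pdivlMr// mulr_suml.
apply: (@le_trans _ _ (2 * (4 * s ^+ 2 + 4 * s ^+ 2))); last by lra.
rewrite -ler_pdivrMl// (le_trans _ h)// mulr_sumr; apply: ler_sum => i _.
rewrite !kernelN /defect -subr_ge0.
set a := diff2 _ _; set b := diff2 _ _; set c := k _; set c' := k _.
have -> : c * c' * a ^+ 2 + c * c' * b ^+ 2 - 2^-1 * (c * (a + b) ^+ 2 * c') =
  c * c' * ((a - b) ^+ 2 / 2) by field.
have k0 := kernel_ge0 hk.
by rewrite mulr_ge0 ?divr_ge0 ?sqr_ge0 ?mulr_ge0// /c /c' ?k0.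
Qed.

End SecondDifferences.

(** * The curvature-dimension inequality *)

Lemma second_moment (R : realType) (k : int -> R) : is_kernel k ->
  (\esum_(j in [set j : nat | (0 < j)%N]) (k j%:Z * j%:R ^+ 2)%:E < +oo)%E ->
  exists Q : R, forall n, \sum_(1 <= j < n) k j%:Z * j%:R ^+ 2 <= Q.
Proof.
move=> hk hmom; exists (fine (\esum_(j in [set j : nat | (0 < j)%N])
  (k j%:Z * j%:R ^+ 2)%:E)) => n.
rewrite -lee_fin fineK.
  apply: (sum_le_esum _ _ _ (fun j : nat => k j%:Z * j%:R ^+ 2)).
    exact: iota_uniq.
  by move=> j /=; rewrite mem_index_iota => /andP[].
rewrite ge0_fin_numE// esum_ge0// => j _.
by rewrite lee_fin mulr_ge0 ?sqr_ge0// (kernel_ge0 hk).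
Qed.

(** The constant C depends on the kernel only.  The bound s is any positive
    number with Gamma2 <= s^2 and not the square root of Gamma2, because it is
    the weight, divided by, in [weighted_double_sum_le]. *)
Lemma sum_symdiff_le (R : realType) (k : int -> R) : is_kernel k ->
  (\esum_(j in [set j : nat | (0 < j)%N]) (k j%:Z * j%:R ^+ 2)%:E < +oo)%E ->
  (exists j0 : nat, (0 < j0)%N /\
     forall i j : nat, (j0 <= i)%N -> (i <= j)%N -> k j%:Z <= k i%:Z) ->
  exists2 C : R, 0 < C & forall u x s n, 0 < s ->
    (Gamma2 k u x <= (s ^+ 2)%:E)%E ->
    \sum_(1 <= j < n) k j%:Z * `|symdiff u x j| <= C * s.
Proof.
move=> hk hmom [N [N0 kd]]; have k0 := kernel_ge0 hk.
have headle u x s m n : (0 < m)%N -> 0 < s -> (Gamma2 k u x <= (s ^+ 2)%:E)%E ->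
    \sum_(1 <= j < n) k j%:Z * `|symdiff u x j| <=
    2 * s * m%:R + \sum_(m <= j < n) k j%:Z * `|symdiff u x j|.
  move=> m0 s0 Gs; apply: sum_head_tail_le => // j.
  by rewrite mulr_ge0//= kernel_symdiff_le// ltW.
have [[M [NM kM0]]|kpos] := pselect (exists M, (N <= M)%N /\ k M%:Z = 0).
  have M0 : (0 < M)%N by exact: leq_trans NM.
  (* The kernel vanishes from M on: only the indices below M contribute. *)
  exists (2 * M%:R); first by rewrite mulr_gt0 ?ltr0n.
  move=> u x s n s0 Gs; apply: le_trans (headle _ _ _ _ n M0 s0 Gs) _.
  rewrite big_nat_cond big1 => [|j]; first by rewrite addr0 mulrAC.
  rewrite andbT => /andP[Mj _]; suff -> : k j%:Z = 0 by rewrite mul0r.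
  by apply/eqP; rewrite eq_le k0 -kM0 kd.
have {}kpos i : (N <= i)%N -> 0 < k i%:Z.
  move=> ji; rewrite lt_neqAle k0 andbT; apply/eqP => ki.
  by apply: kpos; exists i.
have [Q HQ] := second_moment _ _ hk hmom.
have Q0 : 0 <= Q by have := HQ 0%N; rewrite big_geq.
have kN := kpos N (leqnn N); have k2N := kpos (2 * N)%N (leq_pmull N (ltn0Sn 1)).
(* In order: the indices below N, the linear part a * j of the growth bound,
   and the accumulated defects, for which E is 16 * s ^+ 2 / k N. *)
exists (2 * N%:R + (2 / k (2 * N)%N%:Z * Q + (8 / k N%:Z + Q))).
  by rewrite ltr_wpDr ?mulr_gt0 ?ltr0n// !addr_ge0 ?mulr_ge0 ?invr_ge0 ?k0.
move=> u x s n s0 Gs; apply: le_trans (headle _ _ _ _ n N0 s0 Gs) _.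
rewrite [leRHS]mulrDl [2 * N%:R * s]mulrAC lerD2l.
(* k is smallest at 2N among the indices from N to 2N. *)
set a := 2 * s / k (2 * N)%N%:Z.
have growthj j : (N <= j)%N -> `|symdiff u x j| <=
    a * j%:R + \sum_(N <= i < j) `|defect u x N i|.
  apply: almost_additive_growth => // [i /andP[Ni i2N]|i _]; last exact: symdiffD.
  rewrite /a ler_pdivlMr//; apply: le_trans (kernel_symdiff_le _ _ _ hk _ i (ltW s0) Gs).
  by rewrite mulrC; apply: ler_wpM2r => //; exact: kd.
have E := sum_defect_le _ _ _ hk s N n kN Gs.
have W := weighted_double_sum_le _ (fun j => k j%:Z) _ _ _ _ _ _
  N0 s0 (fun j => k0 j%:Z) kpos kd E (HQ n).
apply: (@le_trans _ _ (\sum_(N <= j < n) (a * (k j%:Z * j%:R ^+ 2) +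
    k j%:Z * \sum_(N <= i < j) `|defect u x N i|))).
  apply: ler_sum_nat => j /andP[Nj _].
  apply: (le_trans (ler_wpM2l (k0 j) (growthj j Nj))).
  rewrite mulrDr lerD2r mulrCA; apply: ler_wpM2l; first by rewrite divr_ge0 ?mulr_ge0// ltW.
  apply: ler_wpM2l => //; rewrite expr2 ler_peMr// ler1n; exact: leq_trans Nj.
rewrite big_split/= -mulr_sumr.
have aQ : a * \sum_(N <= j < n) k j%:Z * j%:R ^+ 2 <= a * Q.
  apply: ler_wpM2l; first by rewrite divr_ge0 ?mulr_ge0// ltW.
  have kj0 j : 0 <= k j%:Z * j%:R ^+ 2 by rewrite mulr_ge0// sqr_ge0.
  have [Nn|nN] := leqP N n; last by rewrite (big_geq (ltnW nN)).
  apply: le_trans (HQ n); rewrite [leRHS](big_cat_nat (n := N))//= lerDr.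
  exact: sumr_ge0.
apply: (le_trans (lerD aQ W)); rewrite le_eqVlt; apply/orP; left; apply/eqP.
by rewrite /a; field; rewrite !gt_eqF.
Qed.

Lemma gen_le (R : realType) (k u : int -> R) (x : int) (B : R) : is_kernel k ->
  admissible k u x ->
  (forall n, \sum_(1 <= j < n) k j%:Z * `|symdiff u x j| <= B) ->
  `|gen k u x| <= B.
Proof.
move=> hk adm hB; apply: zsum_le_window; first exact: gen_summable.
move=> n; rewrite sum_window (kernel0 hk) mul0r add0r.
apply: le_trans (ler_norm_sum _ _ _) (le_trans _ (hB n.+1)).
apply: ler_sum => j _; rewrite kernelN// -mulrDr normrM ger0_norm ?(kernel_ge0 hk)//.
by rewrite /symdiff le_eqVlt; apply/orP; left; apply/eqP; congr (_ * `|_|); ring.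
Qed.

Theorem mainTheorem6 (R : realType) (k : int -> R) (hk : is_kernel k)
    (hmom : (\esum_(j in [set j : nat | (0 < j)%N])
               (k j%:Z * j%:R ^+ 2)%:E < +oo)%E)
    (hmono : exists j0 : nat, (0 < j0)%N /\
       forall i j : nat, (j0 <= i)%N -> (i <= j)%N -> k j%:Z <= k i%:Z) :
  exists d : R, 0 < d /\ CD0 k d.
Proof.
have [C C0 HC] := sum_symdiff_le _ _ hk hmom hmono.
exists (C ^+ 2); split=> [|x u adm]; first exact: exprn_gt0.
have G0 : (0 <= Gamma2 k u x)%E.
  rewrite mule_ge0 ?lee_fin ?invr_ge0// esum_ge0// => p _.
  by rewrite lee_fin mulr_ge0 ?sqr_ge0// mulr_ge0// (kernel_ge0 hk).
case EG : (Gamma2 k u x) G0 => [G| |]; last 2 first.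
- by move=> _; rewrite leey.
- by rewrite leeNy_eq.
(* G may vanish: use s = sqrt (G + e) > 0 and let e tend to 0. *)
rewrite !lee_fin => G0; apply/ler_addgt0Pr => e e0.
have Ge : 0 < G + e by lra.
have s0 : 0 < Num.sqrt (G + e) by rewrite sqrtr_gt0.
have : `|gen k u x| <= C * Num.sqrt (G + e).
  apply: gen_le => // n; apply: HC => //.
  by rewrite EG lee_fin sqr_sqrtr ?(ltW Ge)// lerDl ltW.
rewrite -ler_sqr ?nnegrE ?mulr_ge0 ?(ltW C0) ?(ltW s0)// real_normK ?num_real// exprMn sqr_sqrtr ?(ltW Ge)//.
by rewrite ler_pdivrMl// exprn_gt0.
Qed.
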